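(* Let $(X,\sigma)$ and $(Y,\sigma)$ be two Toeplitz shifts and let $x_0\in X$ be a Toeplitz sequence. If there exists a topological factor map $\pi:(X,\sigma)\to(Y,\sigma)$, then $\pi(x_0)$ is a Toeplitz sequence in $Y$.
   Context: For a finite alphabet $A$, $A^{\mathbb Z}$ carries the product topology and $\sigma$ is the shift map $(\sigma(x))_n=x_{n+1}$. A shift is a pair $(X,\sigma)$ with $X\subseteq A^{\mathbb Z}$ closed and $\sigma(X)=X$. Different shifts may have different finite alphabets. For $x\in A^{\mathbb Z}$, $p\in\mathbb N$, $p\ge 1$ and $a\in A$, let ${\rm Per}_p(x,a)=\{n\in\mathbb Z: x_m=a \text{ for all } m\equiv n \pmod p\}$ and ${\rm Per}_p(x)=\bigcup_{a\in A}{\rm Per}_p(x,a)$. The $p$-skeleton of $x$ is the sequence obtained from $x$ by replacing $x_n$ by a new symbol $*$ for every $n\notin{\rm Per}_p(x)$. The integer $p$ is an essential period of $x$ if the $p$-skeleton of $x$ is not periodic with any smaller period. A period structure for $x$ is a sequence of positive integers $(p_i)_{i\ge 1}$ such that each $p_i$ is an essential period of $x$, $p_i\mid p_{i+1}$ for every $i$, and $\bigcup_i {\rm Per}_{p_i}(x)=\mathbb Z$. A sequence $x$ that is not shift-periodic and has a period structure is called a Toeplitz sequence. A Toeplitz shift is a shift $(X,\sigma)$ where $X$ is the closure of the orbit $\{\sigma^n(x):n\in\mathbb Z\}$ of some Toeplitz sequence $x$. A topological factor map $\pi:(X,\sigma)\to(Y,\sigma)$ is a continuous surjection with $\pi\circ\sigma=\sigma\circ\pi$;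 the conclusion is asserted for every such $\pi$. *)

(* Defs.v *)
From HB Require Import structures.
From mathcomp Require Import all_boot all_order all_algebra.
From mathcomp Require Import boolp classical_sets functions topology.

Set Implicit Arguments.
Unset Strict Implicit.
Unset Printing Implicit Defensive.

Import Order.TTheory GRing.Theory Num.Theory.
Local Open Scope classical_set_scope.
Local Open Scope ring_scope.

Definition biseq (A : finType) : Type := {ptws int -> discrete_topology A}.

HB.instance Definition _ (A : finType) := Topological.on (biseq A).

(* shiftz k is the k-th iterate of the shift, for k of any sign *)
Definition shiftz (A : finType) (k : int) (x : biseq A) : biseq A :=
  fun n => x (n + k).

Definition shift (A : finType) (x : biseq A) : biseq A := shiftz 1 x.

Lemma shiftz0 (A : finType) (x : biseq A) : shiftz 0 x = x.
Proof. by apply/funext => n; rewrite /shiftz addr0. Qed.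

Lemma shiftzD (A : finType) (j k : int) (x : biseq A) :
  shiftz (j + k) x = shiftz j (shiftz k x).
Proof. by apply/funext => n; rewrite /shiftz addrA. Qed.

Lemma shiftz_nat (A : finType) (k : nat) (x : biseq A) :
  shiftz k%:Z x = iter k (@shift A) x.
Proof.
elim: k => [|k IHk]; first exact: shiftz0.
by rewrite iterS -IHk /shift -shiftzD.
Qed.

Definition orbit (A : finType) (x : biseq A) : set (biseq A) :=
  [set shiftz k x | k in [set: int]].

Definition is_shift (A : finType) (X : set (biseq A)) : Prop :=
  closed X /\ @shift A @` X = X.

Definition periodic (T : Type) (q : nat) (s : int -> T) : Prop :=
  forall n : int, s (n + q%:Z) = s n.

Definition shift_periodic (A : finType) (x : biseq A) : Prop :=
  exists2 k : nat, (0 < k)%N & iter k (@shift A) x = x.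

Definition Per_at (A : finType) (p : nat) (x : biseq A) (a : A) : set int :=
  [set n | forall m : int, (m = n %[mod p%:Z])%Z -> x m = a].

Definition Per (A : finType) (p : nat) (x : biseq A) : set int :=
  \bigcup_(a in [set: A]) Per_at p x a.

(* None is the new symbol * *)
Definition skeleton (A : finType) (p : nat) (x : biseq A) : int -> option A :=
  fun n => if `[< Per p x n >] then Some (x n) else None.

Definition essential_period (A : finType) (p : nat) (x : biseq A) : Prop :=
  (0 < p)%N /\
  forall q : nat, (0 < q)%N -> (q < p)%N -> ~ periodic q (skeleton p x).

(* The sequence is indexed from 0 instead of 1. *)
Definition period_structure (A : finType) (p : nat -> nat) (x : biseq A) :
    Prop :=
  [/\ forall i, essential_period (p i) x,
      forall i, (p i %| p i.+1)%N &
      \bigcup_(i in [set: nat]) Per (p i) x = [set: int]].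

Definition Toeplitz (A : finType) (x : biseq A) : Prop :=
  ~ shift_periodic x /\ exists p : nat -> nat, period_structure p x.

Definition Toeplitz_shift (A : finType) (X : set (biseq A)) : Prop :=
  is_shift X /\ exists2 x : biseq A, Toeplitz x & X = closure (orbit x).

(* A map X -> Y is encoded as a total function of which only the restriction
   to X matters. *)
Definition factor_map (A B : finType) (X : set (biseq A)) (Y : set (biseq B))
    (pi : biseq A -> biseq B) : Prop :=
  [/\ {within X, continuous pi},
      pi @` X = Y &
      forall x, X x -> pi (shift x) = shift (pi x)].

(* Main.v *)
Require Import Defs.
From mathcomp Require Import all_boot all_order all_algebra.
From mathcomp Require Import boolp classical_sets functions topology.

(** The coordinates of [y := pi x0] are read off from a single one, since
    [y n = (pi (shiftz n x0)) 0].  Let [p] be a period structure of [x0].  If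
    [m_i] is congruent to [n] modulo [p i] for every [i], then
    [shiftz (m_i) x0] converges to [shiftz n x0]: each coordinate of the limit
    lies in [Per (p i) x0] for [i] large, and from then on the sequence has the
    right symbol there ([shiftz_odometer_cvg]).  By continuity of [pi] at
    [shiftz n x0] alone, [y (m_i) = y n] for some [i].  So no such sequence can
    be chosen with [y (m_i)] always different from [y n], which says that [n]
    is in [Per (p i) y] for some [i]: the sets [Per (p i) y] cover the integers
    ([factor_Per_cover]).

    The [p i] need not be essential periods of [y].  But the skeleton at [p i]
    has a least period [q i], and replacing [p i] by [q i] changes neither [Per]
    nor the divisibility ([period_structure_of_cover]).  Everything rests on one
    equivalence: [r] is a period of the [p]-skeleton exactly when
    [Per p x `<=` Per r x] ([periodic_skeletonP]).

    Finally [y] is not periodic: it lies in the orbit closure of a Toeplitz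
    sequence [z], so long windows of [y] are windows of [z], and these meet every
    class along which [z] is constant; hence a period of [y] would be a period
    of [z] ([Toeplitz_closure_period]). *)

Set Implicit Arguments.
Unset Strict Implicit.
Unset Printing Implicit Defensive.

Import Order.TTheory GRing.Theory Num.Theory.
Local Open Scope classical_set_scope.
Local Open Scope ring_scope.

(** * Convergence in the space of bi-infinite sequences *)

Lemma near_coord (A : finType) (x : biseq A) (n : int) :
  \forall y \near x, y n = x n.
Proof.
apply: (@proj_continuous int (fun _ => discrete_topology A) n x [set x n]).
exact: discrete_set1.
Qed.

Lemma biseq_cvg (A : finType) (F : set_system (biseq A)) (x : biseq A) :
  Filter F -> (forall n, \forall y \near F, y n = x n) -> F --> x.
Proof.
move=> FF Fx; apply/cvg_sup => n U [V] [[W] oW <-] /= Wx WU.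
by apply: filterS (Fx n) => y yn; apply: WU; rewrite /= yn.
Qed.

(** * Periods of a sequence *)

Lemma periodicMz (T : Type) (q : nat) (s : int -> T) :
  periodic q s -> forall (k n : int), s (n + k * q%:Z) = s n.
Proof.
move=> sq; have pos (k : nat) n : s (n + k%:Z * q%:Z) = s n.
  elim: k n => [|k IHk] n; first by rewrite mul0r addr0.
  by rewrite -addn1 PoszD mulrDl mul1r addrA sq.
case=> k n; first exact: pos.
by rewrite NegzE mulNr -{2}[n](subrK (k.+1%:Z * q%:Z)) pos.
Qed.

Lemma periodic_gcdn (T : Type) (q r : nat) (s : int -> T) :
  (0 < q)%N -> periodic q s -> periodic r s -> periodic (gcdn q r) s.
Proof.
move=> q_gt0 /periodicMz sq /periodicMz sr n.
case: (egcdnP r q_gt0) => a b ab _.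
by rewrite -(sr b) -addrA -PoszM -PoszD addnC -ab PoszM sq.
Qed.

Lemma least_period_dvd (T : Type) (q r : nat) (s : int -> T) :
    (0 < q)%N -> periodic q s ->
    (forall t, (0 < t)%N -> (t < q)%N -> ~ periodic t s) ->
  periodic r s -> (q %| r)%N.
Proof.
move=> q_gt0 sq qmin sr.
have g_gt0 : (0 < gcdn q r)%N by rewrite gcdn_gt0 q_gt0.
apply/gcdn_idPl/eqP; rewrite eqn_leq dvdn_leq ?dvdn_gcdl //= leqNgt.
by apply/negP => /(qmin _ g_gt0); apply; exact: periodic_gcdn.
Qed.

(** * The sets of periodic positions and the skeletons *)

Lemma PerP (A : finType) (p : nat) (x : biseq A) (n : int) :
  Per p x n <-> forall m : int, (m = n %[mod p%:Z])%Z -> x m = x n.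
Proof.
split=> [[a _ xa] m mn|xn]; first by rewrite (xa m mn) (xa n).
by exists (x n).
Qed.

Lemma PerMzP (A : finType) (p : nat) (x : biseq A) (n : int) :
  Per p x n <-> forall k : int, x (n + k * p%:Z) = x n.
Proof.
rewrite PerP; split=> [xn k|xn m /eqP].
  by apply: xn; rewrite addrC modzMDl.
by rewrite eqz_mod_dvd => /dvdzP[k] /(canRL (subrK _)) ->; rewrite addrC.
Qed.

Lemma Per_dvd (A : finType) (p q : nat) (x : biseq A) :
  (p %| q)%N -> Per p x `<=` Per q x.
Proof.
move=> /dvdnP[d ->] n /PerMzP xn; apply/PerMzP => k.
by rewrite PoszM mulrA xn.
Qed.

Lemma Per_shift (A : finType) (p : nat) (x : biseq A) (n k : int) :
  Per p x n -> Per p x (n + k * p%:Z).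
Proof.
by move=> /PerMzP xn; apply/PerMzP => l; rewrite -addrA -mulrDl !xn.
Qed.

(** If [n] is in [Per p x], then so is every [n + k * p], hence all of these are
    in [Per r x]: translating by a multiple of [r] therefore preserves the
    symbol on the whole class of [n] modulo [p], so it stays in [Per p x]. *)
Lemma periodic_skeletonP (A : finType) (p r : nat) (x : biseq A) :
  periodic r (skeleton p x) <-> Per p x `<=` Per r x.
Proof.
split=> [/periodicMz sr n xn|sub n].
  apply/PerMzP => k; move: (sr k n); rewrite /skeleton (asboolT xn).
  by case: ifP => // _ [].
have step m k : Per p x m -> Per p x (m + k * r%:Z).
  move=> xm; apply/PerMzP => l; rewrite addrAC.
  have /sub/PerMzP -> := Per_shift l xm.
  by have /sub/PerMzP -> := xm; have /PerMzP -> := xm.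
have PerE : Per p x (n + r%:Z) = Per p x n.
  apply/propext; split=> [/(step _ (- 1))|/(step _ 1)]; last by rewrite mul1r.
  by rewrite mulN1r addrK.
rewrite /skeleton PerE; case: asboolP => // /sub/PerMzP/(_ 1).
by rewrite mul1r => ->.
Qed.

(** The least period of the [p]-skeleton is essential, as its own skeleton is
    the one at [p]. *)
Lemma essential_reduction (A : finType) (p : nat) (x : biseq A) :
    (0 < p)%N ->
  exists q : nat, [/\ essential_period q x, Per q x = Per p x &
    forall r, Per p x `<=` Per r x -> (q %| r)%N].
Proof.
move=> p_gt0; pose isper q := (0 < q)%N && `[< periodic q (skeleton p x) >].
have perp : periodic p (skeleton p x) by apply/periodic_skeletonP.
have exq : exists q, isper q by exists p; rewrite /isper p_gt0; apply/asboolP.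
case: (ex_minnP exq) => q /andP[q_gt0 /asboolP perq] minq.
have qmin t : (0 < t)%N -> (t < q)%N -> ~ periodic t (skeleton p x).
  move=> t_gt0 tq pert; move: tq; rewrite ltnNge minq // /isper t_gt0.
  exact/asboolP.
have PerE : Per q x = Per p x.
  rewrite eqEsubset; split; last exact/periodic_skeletonP.
  by apply: Per_dvd; exact: least_period_dvd perp.
have skelE : skeleton q x = skeleton p x by rewrite /skeleton PerE.
exists q; split=> //; first by split=> // t; rewrite skelE; exact: qmin.
by move=> r /periodic_skeletonP; exact: least_period_dvd.
Qed.

Lemma period_structure_of_cover (A : finType) (p : nat -> nat) (x : biseq A) :
    (forall i, 0 < p i)%N -> (forall i, p i %| p i.+1)%N ->
    \bigcup_(i in [set: nat]) Per (p i) x = [set: int] ->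
  exists q, period_structure q x.
Proof.
move=> p_gt0 p_dvd cover.
have [q qP] := choice (fun i => essential_reduction x (p_gt0 i)).
exists q; split=> [i|i|]; first by case: (qP i).
  have [_ _ ->//] := qP i; have [_ -> _] := qP i.+1.
  exact: Per_dvd.
by rewrite -cover; apply: eq_bigcupr => i _; case: (qP i).
Qed.

Lemma near_Per (A : finType) (p : nat -> nat) (x : biseq A) (n : int) :
  period_structure p x -> \forall i \near \oo, Per (p i) x n.
Proof.
move=> [_ p_dvd cover].
have [i _ xn] : (\bigcup_i Per (p i) x) n by rewrite cover.
exists i => // j /= ij; apply: Per_dvd xn.
exact: (homo_leq dvdnn dvdn_trans p_dvd).
Qed.

(** * Image of a Toeplitz sequence under a factor map *)

Lemma shiftz_odometer_cvg (A : finType) (p : nat -> nat) (x : biseq A)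
    (m : nat -> int) (n : int) :
    period_structure p x -> (forall i, m i = n %[mod (p i)%:Z])%Z ->
  shiftz (m i) x @[i --> \oo] --> shiftz n x.
Proof.
move=> xp mn; apply: biseq_cvg => l.
apply: (@filterS _ \oo) (near_Per (l + n) xp) => i /PerP xi.
by apply: xi; rewrite -modzDmr mn modzDmr.
Qed.

Lemma factor_shiftz (A B : finType) (X : set (biseq A)) (Y : set (biseq B))
    (pi : biseq A -> biseq B) (x : biseq A) (k : int) :
    is_shift X -> factor_map X Y pi -> X x ->
  X (shiftz k x) /\ pi (shiftz k x) = shiftz k (pi x).
Proof.
move=> [_ shX] [_ _ piS] Xx.
have XS z : X z -> X (shift z) by move=> Xz; rewrite -shX; exists z.
have pos (j : nat) z : X z ->
    X (shiftz j%:Z z) /\ pi (shiftz j%:Z z) = shiftz j%:Z (pi z).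
  move=> Xz; elim: j => [|j [Xj IHj]]; first by rewrite !shiftz0.
  rewrite !shiftz_nat !iterS -!shiftz_nat.
  by split; [exact: XS | rewrite piS // IHj].
case: k => j; first exact: pos.
(* a negative shift of x is found by pulling x back inside X *)
have [z Xz zx] : exists2 z, X z & shiftz j.+1%:Z z = x.
  elim: j.+1 => [|i [z]]; first by exists x; rewrite ?shiftz0.
  rewrite -{1}shX => -[w Xw <-] <-; exists w => //.
  by rewrite -addn1 PoszD shiftzD.
by rewrite NegzE -zx (proj2 (pos j.+1 z Xz)) -!shiftzD addNr !shiftz0.
Qed.

Lemma factor_Per_cover (A B : finType) (X : set (biseq A)) (Y : set (biseq B))
    (pi : biseq A -> biseq B) (p : nat -> nat) (x : biseq A) :
    is_shift X -> factor_map X Y pi -> X x -> period_structure p x ->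
  \bigcup_(i in [set: nat]) Per (p i) (pi x) = [set: int].
Proof.
move=> shX fpi Xx xp; apply/seteqP; split=> // n _.
have piz k : pi (shiftz k x) 0 = pi x k.
  by rewrite (proj2 (factor_shiftz k shX fpi Xx)) /shiftz add0r.
apply: contrapT => nPer.
have bad i : exists m : int, (m = n %[mod (p i)%:Z])%Z /\ pi x m <> pi x n.
  apply: contrapT => none; apply: nPer; exists i => //.
  apply/PerP => m mn; apply: contrapT => neq; apply: none.
  by exists m.
have [m mP] := choice bad.
have mn i : (m i = n %[mod (p i)%:Z])%Z by case: (mP i).
have [/subspace_continuousP piC _ _] := fpi.
have Xn := proj1 (factor_shiftz n shX fpi Xx).
(* within-X continuity, read as a neighbourhood condition in the full space *)
have near_pi : \forall z \near shiftz n x, X z -> pi z 0 = pi (shiftz n x) 0.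
  exact: (piC _ Xn _ (near_coord _ 0)).
have [N _ /(_ N (leqnn N))] := shiftz_odometer_cvg xp mn near_pi.
move=> /(_ (proj1 (factor_shiftz (m N) shX fpi Xx))).
by rewrite !piz; case: (mP N).
Qed.

(** Take a term [q] of the period structure with [n] and [n + k] both in
    [Per q z].  On the coordinates [0 .. q + k - 1], [y] agrees with some shift
    of [z].  The first [q] of them meet the class that corresponds to that of [n]
    modulo [q], so [y m = y (m + k)] there gives [z n = z (n + k)]. *)
Lemma Toeplitz_closure_period (A : finType) (z y : biseq A) (k : nat) :
    Toeplitz z -> closure (Defs.orbit z) y ->
  iter k (@shift A) y = y -> iter k (@shift A) z = z.
Proof.
move=> [_ [p zp]] zy; rewrite -!shiftz_nat => yk; apply/funext => n.
have [N _ /(_ N (leqnn N))[/PerP zn /PerP znk]] :=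
  filterI (near_Per n zp) (near_Per (n + k%:Z) zp).
rewrite /shiftz.
have pN_gt0 : (0 < p N)%N by case: zp => /(_ N)[].
have [_ [[j _ <-]] win] := zy _ (filterI
  (filter_forall _ (fun m : 'I_(p N) => near_coord y m%:Z))
  (filter_forall _ (fun m : 'I_(p N) => near_coord y (m%:Z + k%:Z)))).
pose r := ((n - j) %% p N)%Z.
have r_ge0 : 0 <= r by rewrite modz_ge0 // eqz_nat -lt0n.
have r_lt : (`|r|%N < p N)%N by rewrite -ltz_nat gez0_abs // ltz_pmod.
have rj : (r + j = n %[mod p N])%Z by rewrite modzDml subrK.
case: win => /(_ (Ordinal r_lt)) /= + /(_ (Ordinal r_lt)) /=.
rewrite /shiftz gez0_abs // (zn _ rj) -addrA (addrC k%:Z) addrA.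
rewrite (znk (r + j + k%:Z)); last by rewrite -modzDml rj modzDml.
by move=> -> ->; rewrite -[in RHS]yk.
Qed.

Theorem proposition3p10 (A B : finType) (X : set (biseq A)) (Y : set (biseq B))
    (hX : Toeplitz_shift X) (hY : Toeplitz_shift Y)
    (x0 : biseq A) (hx0X : X x0) (hx0 : Toeplitz x0)
    (pi : biseq A -> biseq B) (hpi : factor_map X Y pi) :
  Y (pi x0) /\ Toeplitz (pi x0).
Proof.
have [shX _] := hX; have [_ piX _] := hpi; have [_ [p px0]] := hx0.
have Yy : Y (pi x0) by rewrite -piX; exists x0.
split=> //; split.
  have [_ [z zT YE]] := hY; move=> [k k_gt0 yk]; case: (zT) => + _; apply.
  exists k => //; rewrite YE in Yy.
  exact: Toeplitz_closure_period zT Yy yk.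
have [pP p_dvd _] := px0.
apply: (@period_structure_of_cover _ p) => // [i|]; first by case: (pP i).
exact: factor_Per_cover shX hpi hx0X px0.
Qed.
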